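(* Let $m\le n$ be positive integers. There exist constants $\varepsilon, c, C>0$ depending only on $n$ such that the following holds. Let $B$ be a set, let $N>0$, and let $T\subseteq B^n$ be a nonempty finite subset satisfying $$|Pr_{1,2,\ldots,\widehat{k},\ldots,n}(T)|\le N\qquad\text{for every } 1\le k\le n .$$ Then there is a subset $T'\subseteq T$ with $|T'|\ge\varepsilon|T|$ such that all of the following hold: (1) for every $y\in Pr_{1,2,\ldots,m}(T')$ and every $m<j\le n$, $$\big|\{z\in Pr_{1,2,\ldots,\widehat{j},\ldots,n}(T') : Pr_{1,2,\ldots,m}(z)=y\}\big|\ \ge\ c\,\frac{|T|^{n-m-1}}{N^{n-m-1}};$$ (2) for every $y\in Pr_{1,2,\ldots,m}(T')$, $$\big|\{x\in T' : Pr_{1,2,\ldots,m}(x)=y\}\big|\ \ge\ c\,\frac{|T|^{n-m}}{N^{n-m}};$$ (3) $$|Pr_{1,2,\ldots,m}(T')|\ \le\ C\,\frac{N^{n-m}}{|T|^{n-m-1}};$$ (4) for every $1\le j\le m$, $$|Pr_{1,2,\ldots,\widehat{j},\ldots,m}(T')|\ \le\ C\,\frac{N^{n-m+1}}{|T|^{n-m}}.$$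
   Context: For $x=(x_1,\ldots,x_n)\in B^n$ and indices $1\le k_1<\cdots<k_t\le n$, $Pr_{k_1,\ldots,k_t}(x)=(x_{k_1},\ldots,x_{k_t})$, and $Pr_{k_1,\ldots,k_t}(T)=\{Pr_{k_1,\ldots,k_t}(x):x\in T\}$. A hat over an index means that the index is omitted from the list (if no index remains, the projection of a nonempty set is a single point). Projections are composed in the obvious way: if $j_1,\ldots,j_{t_1}$ is a subsequence of $k_1,\ldots,k_{t_2}$, then for $z\in Pr_{k_1,\ldots,k_{t_2}}(T)$ the element $Pr_{j_1,\ldots,j_{t_1}}(z)$ is obtained by retaining only the coordinates of $z$ with original indices $j_1,\ldots,j_{t_1}$; it is the common value of $Pr_{j_1,\ldots,j_{t_1}}(x)$ over all $x\in T$ with $Pr_{k_1,\ldots,k_{t_2}}(x)=z$. *)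

(* Defs.v *)
From HB Require Import structures.
From mathcomp Require Import all_boot all_order all_algebra.
From mathcomp Require Import finmap reals.

Set Implicit Arguments.
Unset Strict Implicit.
Unset Printing Implicit Defensive.

Import Order.TTheory GRing.Theory Num.Theory.

(* [B ^ n] is MathComp's {ffun 'I_n -> B}.  Coordinates are numbered from 0, so
   an increasing list of indices k_1 < ... < k_t is a set K : {set 'I_n}, and
   (x_{k_1}, ..., x_{k_t}) is a function on K.  For K = set0 this type has
   exactly one element. *)
Definition coords (n : nat) (B : Type) (K : {set 'I_n}) :=
  {ffun {i : 'I_n | i \in K} -> B}.

Definition Pr (n : nat) (B : Type) (K : {set 'I_n}) (x : (B ^ n)%type) :
    coords B K :=
  [ffun i : {i : 'I_n | i \in K} => x (val i)].

Definition PrS (n : nat) (B : choiceType) (K : {set 'I_n})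
    (T : {fset (B ^ n)%type}) : {fset coords B K} :=
  [fset Pr K x | x in T]%fset.

Definition sub_index (n : nat) (J K : {set 'I_n}) (sJK : J \subset K)
    (i : {i : 'I_n | i \in J}) : {i : 'I_n | i \in K} :=
  exist _ (val i) (subsetP sJK (val i) (valP i)).

(* Projection of an already projected point, retaining the coordinates whose
   original index lies in J. *)
Definition rePr (n : nat) (B : Type) (J K : {set 'I_n}) (sJK : J \subset K)
    (z : coords B K) : coords B J :=
  [ffun i : {i : 'I_n | i \in J} => z (sub_index sJK i)].

Lemma rePrE (n : nat) (B : Type) (J K : {set 'I_n}) (sJK : J \subset K)
    (x : (B ^ n)%type) : rePr sJK (Pr K x) = Pr J x.
Proof. by apply/ffunP => i; rewrite !ffunE. Qed.

(* The indices 1, ..., m of the usual numbering. *)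
Definition firsts (n m : nat) : {set 'I_n} := [set i : 'I_n | (i < m)%N].

Lemma firsts_sub (n m : nat) (j : 'I_n) (hj : (m <= j)%N) :
  firsts n m \subset [set~ j].
Proof.
apply/subsetP => i; rewrite !inE => lt_im.
by apply: contraTneq lt_im => ->; rewrite -leqNgt.
Qed.

(* Main.v *)
Require Import Defs.
From HB Require Import structures.
From mathcomp Require Import all_boot all_order all_algebra.
From mathcomp Require Import finmap reals.
From mathcomp Require Import ring lra.

(** Call the points of [S] that agree with [x] off one coordinate the line of
    [S] through [x] in that direction, and put [d = |T| / N].  The lines of [T]
    in direction [k] are indexed by the projection of [T] that forgets [k], so
    there are at most [N] of them and they have at least [d] points
    on average.
    Deleting, as long as there is one, a line with fewer than
    [a = d / (2 n)] points loses at most [n N a = |T| / 2] points, because each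
    deletion removes a point from one of the [n] projections
    ([exists_rich_subset]).  What remains is a set [T'] with [|T'| >= |T| / 2],
    all of whose lines have at least [a] points.

    Moving from a point of [T'] along lines in the directions of a set [D], one
    after the other, reaches at least [a ^ |D|] points of [T'] which agree with
    the original one off [D] ([card_box_ge]), and these points stay distinct in
    every projection that keeps the coordinates in [D] ([card_proj_fiber_ge]).
    The two lower bounds on fibres are instances of this, where [D] consists of
    the last [n - m] directions, or of these without [j].  The upper bounds
    follow by counting.  The fibres of [T'] over its projection to the first [m]
    coordinates are disjoint, and each has at least [a ^ (n - m)] points, which
    bounds the size of this projection by [|T| / a ^ (n - m)].  Likewise, when
    [j] is one of the first [m] directions, the projection of [T'] forgetting
    [j] has at most [N] points, and its fibres over the projection to the first
    [m] coordinates without [j] have at least [a ^ (n - m)] points each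
    ([card_PrS_mul_le]). *)

Set Implicit Arguments.
Unset Strict Implicit.
Unset Printing Implicit Defensive.

Import Order.TTheory GRing.Theory Num.Theory.
Local Open Scope fset_scope.
Local Open Scope ring_scope.

(** * Counting by fibres *)

Lemma card_imfset_fibers (R : numDomainType) (U V : choiceType) (f : U -> V)
    (A : {fset U}) (b : R) :
  (forall x, x \in A -> b <= #|` [fset z in A | f z == f x]|%:R) ->
  #|` f @` A|%:R * b <= #|` A|%:R.
Proof.
move=> fib; rewrite [#|` A|]card_fset_sum1 (partition_big_imfset _ f) /=.
rewrite natr_sum card_fset_sum1 natr_sum mulr_suml big_seq [leRHS]big_seq.
apply: ler_sum => _ /imfsetP[x /= xA ->]; rewrite mul1r.
apply: (le_trans (fib x xA)); rewrite ler_nat card_fset_sum1.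
by rewrite [leqRHS]big_fset_condE.
Qed.

Lemma leq_card_imfset_in (U V : choiceType) (f : U -> V) (A : {fset U})
    (C : {fset V}) :
  {in A &, injective f} -> (forall x, x \in A -> f x \in C) ->
  (#|` A| <= #|` C|)%N.
Proof.
move=> inj_f fA; have <- : #|` f @` A| = #|` A| by exact: card_in_imfset.
by apply/fsubset_leq_card/fsubsetP => _ /imfsetP[x /= xA ->]; exact: fA.
Qed.

(** * Projections and fibres *)

Section Projections.
Variables (n : nat) (B : choiceType).
Implicit Types (S : {fset (B ^ n)%type}) (x z w : (B ^ n)%type).
Implicit Types (D E J K : {set 'I_n}).

(** The points of [S] that have the same coordinates as [x] in [K].  The case
    [K = [set~ k]] is the line of [S] through [x] in direction [k]. *)
Definition fiber K S x : {fset (B ^ n)%type} :=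
  [fset z in S | Pr K z == Pr K x].

Lemma eq_PrP K x z : reflect (forall i, i \in K -> x i = z i) (Pr K x == Pr K z).
Proof.
apply: (iffP eqP) => [/ffunP e i iK|e].
  by have := e (exist _ i iK); rewrite !ffunE.
by apply/ffunP => i; rewrite !ffunE; apply: e; exact: valP i.
Qed.

Lemma in_fiber K S x z : (z \in fiber K S x) = (z \in S) && (Pr K z == Pr K x).
Proof. by rewrite !inE. Qed.

Lemma fiber_sub K S x : fiber K S x `<=` S.
Proof. by apply/fsubsetP => z; rewrite in_fiber => /andP[]. Qed.

Lemma sub_fiber J K S x : J \subset K -> fiber K S x `<=` fiber J S x.
Proof.
move=> /subsetP sJK; apply/fsubsetP => z; rewrite !in_fiber.
case/andP=> -> /eq_PrP e; apply/eq_PrP => i iJ; exact/e/sJK.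
Qed.

(** Two points that agree off [D] and have the same projection to a set of
    indices containing [D] are equal. *)
Lemma Pr_fiber_inj D E S x : D \subset E ->
  {in fiber (~: D) S x &, injective (Pr E)}.
Proof.
move=> /subsetP sDE z w; rewrite !in_fiber.
move=> /andP[_ /eq_PrP ez] /andP[_ /eq_PrP ew] /eqP /eq_PrP e.
apply/ffunP => i; have [iD|iD] := boolP (i \in D); first exact/e/sDE.
by rewrite ez ?ew // inE.
Qed.

Lemma imfset_rePr J K (sJK : J \subset K) S : rePr sJK @` PrS K S = PrS J S.
Proof.
apply/fsetP => y; apply/imfsetP/imfsetP => /= -[].
  by move=> _ /imfsetP[x /= xS ->] ->; exists x; rewrite // rePrE.
by move=> x xS ->; exists (Pr K x); [exact: in_imfset | rewrite rePrE].
Qed.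

Lemma PrS_subset K S S' : S' `<=` S -> PrS K S' `<=` PrS K S.
Proof.
move=> /fsubsetP sS; apply/fsubsetP => _ /imfsetP[x /= xS ->].
exact/in_imfset/sS.
Qed.

Lemma card_PrS_setD_fiber K S x : x \in S ->
  (#|` PrS K (S `\` fiber K S x)| < #|` PrS K S|)%N.
Proof.
move=> xS; apply: fproper_ltn_card; rewrite fproperE PrS_subset ?fsubsetDl //=.
apply/fsubsetPn; exists (Pr K x); first exact: in_imfset.
apply/imfsetP => -[z /= /fsetDP[zS]]; rewrite in_fiber zS /= => nz e.
by rewrite e eqxx in nz.
Qed.

Lemma card_setC_firsts m : (m <= n)%N -> #|~: firsts n m| = (n - m)%N.
Proof.
move=> le_mn; rewrite cardsCs setCK card_ord; congr (_ - _)%N.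
have inj_w : injective (widen_ord le_mn).
  by move=> i j /(congr1 val) /= /val_inj.
rewrite -[RHS](card_ord m) -(card_imset _ inj_w).
apply: eq_card => i; rewrite inE; apply/idP/imsetP => [lt_im|[j _ ->]] //=.
  by exists (Ordinal lt_im) => //; apply: val_inj.
Qed.

(** * Deletion of poor lines *)

(** Deleting the lines that have fewer than [a] points, one at a time: the
    number of deleted points is at most [a] times the decrease of the total
    size of the [n] projections that forget one coordinate. *)
Lemma exists_rich_subset (R : realDomainType) (a : R) S : 0 <= a ->
  exists S' : {fset (B ^ n)%type},
    [/\ S' `<=` S,
        #|` S|%:R + a * (\sum_(k < n) #|` PrS [set~ k] S'|)%:R
          <= #|` S'|%:R + a * (\sum_(k < n) #|` PrS [set~ k] S|)%:R &
        forall x (k : 'I_n), x \in S' -> a <= #|` fiber [set~ k] S' x|%:R].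
Proof.
move=> a_ge0; have [c] := ubnP #|` S|; elim: c S => // c IHc S /ltnSE leSc.
pose poor (k : 'I_n) (x : S) := (#|` fiber [set~ k] S (val x)|%:R < a).
have [/existsP[k /existsP[x]]|rich] := boolP [exists k, exists x, poor k x].
  rewrite /poor; set l := fiber _ _ _ => lt_la.
  have sl : l `<=` S by exact: fiber_sub.
  have xl : val x \in l by rewrite in_fiber eqxx (valP x).
  have cl : (#|` S `\` l| + #|` l| = #|` S|)%N.
    by rewrite cardfsDS // subnK // fsubset_leq_card.
  have lt0l : (0 < #|` l|)%N by rewrite cardfs_gt0; apply/fset0Pn; exists (val x).
  have [|S' [sS' cS' rS']] := IHc (S `\` l).
    by apply: leq_trans leSc; rewrite -cl -[X in (X < _)%N]addn0 ltn_add2l.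
  exists S'; split => //; first exact: fsubset_trans sS' (fsubsetDl _ _).
  have lt_sum : (\sum_(i < n) #|` PrS [set~ i] (S `\` l)| <
                 \sum_(i < n) #|` PrS [set~ i] S|)%N.
    rewrite (bigD1 k) //= [ltnRHS](bigD1 k) //= -addSn leq_add //.
      exact: card_PrS_setD_fiber (valP x).
    by apply: leq_sum => i _; apply/fsubset_leq_card/PrS_subset/fsubsetDl.
  set L0 := (\sum_(i < n) #|` PrS [set~ i] S|)%N.
  set L1 := (\sum_(i < n) #|` PrS [set~ i] (S `\` l)|)%N in lt_sum cS'.
  have le_aL : a * L1%:R + a <= a * L0%:R.
    by rewrite -[X in _ + X]mulr1 -mulrDr natr1 ler_wpM2l // ler_nat.
  rewrite -cl natrD addrAC; apply: le_trans (lerD cS' (ltW lt_la)) _.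
  by rewrite -addrA lerD2l.
exists S; split => // x k xS; rewrite leNgt; apply: contra rich => lt_la.
by apply/existsP; exists k; apply/existsP; exists [` xS].
Qed.

(** * Sets all of whose lines are rich *)

Section Rich.
Variables (R : realDomainType) (a : R) (S : {fset (B ^ n)%type}).
Hypotheses (a_ge0 : 0 <= a)
  (richS : forall x (k : 'I_n), x \in S -> a <= #|` fiber [set~ k] S x|%:R).

(** Each direction of [D] multiplies by at least [a] the number of points that
    can be reached from [x] along lines of [S] in the directions of [D]. *)
Lemma card_box_ge D x : x \in S -> a ^+ #|D| <= #|` fiber (~: D) S x|%:R.
Proof.
have [c] := ubnP #|D|; elim: c D x => // c IHc D x leDc xS.
have [->|[k kD]] := set_0Vmem D.
  rewrite cards0 expr0 ler1n cardfs_gt0; apply/fset0Pn; exists x.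
  by rewrite in_fiber xS eqxx.
set D' := (D :\ k)%SET; set F := fiber (~: D) S x.
have cD : #|D| = #|D'|.+1 by rewrite (cardsD1 k) kD.
have sD'D : ~: D \subset ~: D' by rewrite setCS subD1set.
(* The projection forgetting the directions in D' separates the points of the
   line in direction k through x, and its fibres in F are given by induction. *)
have line_ge : a <= #|` Pr (~: D') @` F|%:R.
  apply: le_trans (richS k xS) _; rewrite ler_nat.
  have sl : fiber [set~ k] S x `<=` F.
    by apply: sub_fiber; rewrite setCS sub1set.
  apply: (leq_card_imfset_in (f := Pr (~: D'))) => [|z zl].
    by apply: Pr_fiber_inj; rewrite sub1set !inE eqxx.
  exact/in_imfset/(fsubsetP sl).
have /card_imfset_fibers : forall z, z \in F ->
    a ^+ #|D'| <= #|` [fset w in F | Pr (~: D') w == Pr (~: D') z]|%:R.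
  move=> z; rewrite in_fiber => /andP[zS /eqP ezx].
  have lt_D'c : (#|D'| < c)%N by rewrite -ltnS -cD.
  apply: le_trans (IHc D' z lt_D'c zS) _; rewrite ler_nat.
  apply/fsubset_leq_card/fsubsetP => w wz.
  have := fsubsetP (sub_fiber S z sD'D) w wz.
  move: wz; rewrite !inE => /andP[-> ->] /= /eqP ->.
  by rewrite ezx eqxx.
by apply: le_trans; rewrite cD exprS ler_wpM2r ?exprn_ge0.
Qed.

Lemma card_proj_fiber_ge D E K (sKE : K \subset E) x :
  D \subset E -> K \subset ~: D -> x \in S ->
  a ^+ #|D| <= #|` [fset z in PrS E S | rePr sKE z == Pr K x]|%:R.
Proof.
move=> sDE sKD xS; apply: le_trans (card_box_ge D xS) _; rewrite ler_nat.
apply: (leq_card_imfset_in (f := Pr E)) => [|z zx]; first exact: Pr_fiber_inj.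
have := fsubsetP (sub_fiber S x sKD) z zx; rewrite in_fiber => /andP[zS ezx].
by rewrite !inE /= rePrE ezx andbT; exact: in_imfset.
Qed.

Lemma card_PrS_mul_le D E K : K \subset E -> D \subset E -> K \subset ~: D ->
  #|` PrS K S|%:R * a ^+ #|D| <= #|` PrS E S|%:R.
Proof.
move=> sKE sDE sKD; rewrite -(imfset_rePr sKE); apply: card_imfset_fibers.
move=> _ /imfsetP[x /= xS ->]; rewrite rePrE.
exact: card_proj_fiber_ge.
Qed.

End Rich.

End Projections.

(** * Sets with small projections *)

Theorem theorem3p2 (R : realType) (n : nat) (n_gt0 : (0 < n)%N) :
  exists eps c C : R,
    [/\ 0 < eps, 0 < c & 0 < C] /\
    forall (m : nat) (m_gt0 : (0 < m)%N) (le_mn : (m <= n)%N)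
      (B : choiceType) (N : R) (N_gt0 : 0 < N) (T : {fset (B ^ n)%type})
      (T_neq0 : T != fset0)
      (T_proj : forall k : 'I_n, #|` PrS [set~ k] T|%:R <= N),
    exists T' : {fset (B ^ n)%type},
      [/\ T' `<=` T,
          eps * #|` T|%:R <= #|` T'|%:R &
      [/\ forall (y : coords B (firsts n m)), y \in PrS (firsts n m) T' ->
            forall (j : 'I_n) (hj : (m <= j)%N),
              c * (#|` T|%:R ^ (n%:Z - m%:Z - 1) / N ^ (n%:Z - m%:Z - 1))
              <= #|` [fset z in PrS [set~ j] T' |
                       rePr (firsts_sub hj) z == y]|%:R,
          forall (y : coords B (firsts n m)), y \in PrS (firsts n m) T' ->
            c * (#|` T|%:R ^ (n%:Z - m%:Z) / N ^ (n%:Z - m%:Z))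
            <= #|` [fset x in T' | Pr (firsts n m) x == y]|%:R,
          #|` PrS (firsts n m) T'|%:R
            <= C * (N ^ (n%:Z - m%:Z) / #|` T|%:R ^ (n%:Z - m%:Z - 1)) &
          forall j : 'I_n, (j < m)%N ->
            #|` PrS (firsts n m :\ j)%SET T'|%:R
              <= C * (N ^ (n%:Z - m%:Z + 1) / #|` T|%:R ^ (n%:Z - m%:Z))]].
Proof.
(* The lines of T' have at least delta * |T| / N points. *)
pose delta : R := (2 * n%:R)^-1.
have n0 : 0 < n%:R :> R by rewrite ltr0n.
have n1 : 1 <= n%:R :> R by rewrite ler1n.
have delta_gt0 : 0 < delta by rewrite invr_gt0 mulr_gt0.
have delta_le1 : delta <= 1 by rewrite invf_le1 ?mulr_gt0 //; lra.
have delta_pow k : (k <= n)%N -> delta ^+ n <= delta ^+ k.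
  by move=> le_kn; apply: ler_wiXn2l => //; exact: ltW.
exists 2^-1, (delta ^+ n), (delta ^+ n)^-1.
split; first by split; rewrite ?invr_gt0 ?exprn_gt0.
move=> m m_gt0 le_mn B N N_gt0 T T_neq0 T_proj.
set t : R := #|` T|%:R.
have t_gt0 : 0 < t by rewrite ltr0n cardfs_gt0.
pose d := t / N; have d_gt0 : 0 < d by exact: divr_gt0.
pose a := delta * d; have a_ge0 : 0 <= a by rewrite mulr_ge0 ?ltW.
have [T' [sT' cT' richT']] := exists_rich_subset T a_ge0.
have a_pow k : (k <= n)%N -> delta ^+ n * d ^+ k <= a ^+ k.
  by move=> le_kn; rewrite [leRHS]exprMn ler_wpM2r ?exprn_ge0 ?delta_pow // ltW.
(* The upper bounds: |P| * a ^ k <= X gives |P| <= C * (X / d ^ k). *)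
have upper (P X : R) k : (k <= n)%N -> 0 <= P -> P * a ^+ k <= X ->
    P <= (delta ^+ n)^-1 * (X / d ^+ k).
  move=> le_kn P_ge0 le_X.
  have dk_gt0 : 0 < d ^+ k by rewrite exprn_gt0.
  rewrite mulrC ler_pdivlMr ?exprn_gt0 // ler_pdivlMr // -mulrA.
  by apply: le_trans le_X; rewrite ler_wpM2l ?a_pow.
set e := (n - m)%N; have le_en : (e <= n)%N by exact: leq_subr.
have -> : n%:Z - m%:Z = e%:Z by rewrite subzn.
have cC : #|~: firsts n m| = e by exact: card_setC_firsts.
have t_neq0 : t != 0 by rewrite gt_eqF.
have N_neq0 : N != 0 by rewrite gt_eqF.
have dE k : d ^+ k = t ^+ k / N ^+ k by rewrite expr_div_n.
exists T'; split => //.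
  (* The total size of the projections of T is at most n * N, and
     a * (n * N) = t / 2. *)
  have : a * (\sum_(k < n) #|` PrS [set~ k] T|)%:R <= a * (n%:R * N).
    rewrite ler_wpM2l // natr_sum -[n in leRHS]card_ord -sum1_card natr_sum.
    by rewrite mulr_suml ler_sum // => k _; rewrite mul1r.
  have -> : a * (n%:R * N) = t / 2.
    by rewrite /a /d /delta; field; rewrite N_neq0 gt_eqF.
  have : 0 <= a * (\sum_(k < n) #|` PrS [set~ k] T'|)%:R by rewrite mulr_ge0.
  move: cT'; rewrite -/t; lra.
have fib x : x \in T' -> a ^+ e <= #|` fiber (firsts n m) T' x|%:R.
  by move=> xT'; have := card_box_ge a_ge0 richT' (~: firsts n m) xT'; rewrite setCK cC.
split.
- move=> _ /imfsetP[x /= xT' ->] j hj.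
  set D := (~: firsts n m :\ j)%SET.
  have cD : e = #|D|.+1 by rewrite -cC (cardsD1 j) !inE -leqNgt hj.
  have -> : e%:Z - 1 = #|D|%:Z by rewrite cD -addn1 PoszD addrK.
  rewrite -[t ^ _]/(t ^+ _) -[N ^ _]/(N ^+ _) -dE.
  have le_Dn : (#|D| <= n)%N by apply: leq_trans le_en; rewrite cD.
  apply: le_trans (a_pow _ le_Dn) _; apply: card_proj_fiber_ge => //.
    by rewrite /D setDE subsetIr.
  by rewrite -setCS setCK subD1set.
- move=> _ /imfsetP[x /= xT' ->].
  rewrite -[t ^ _]/(t ^+ _) -[N ^ _]/(N ^+ _) -dE.
  exact: le_trans (a_pow _ le_en) (fib x xT').
(* For m = n the exponent e - 1 is -1, so the powers of t are split in int. *)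
- have -> : N ^ e%:Z / t ^ (e%:Z - 1) = t / d ^+ e.
    rewrite expfzDr // exprN1 -[t ^ _]/(t ^+ _) -[N ^ _]/(N ^+ _) dE.
    by field; rewrite !expf_neq0.
  apply: upper => //; apply: le_trans (card_imfset_fibers fib) _.
  by rewrite ler_nat fsubset_leq_card.
- move=> j lt_jm.
  have -> : N ^ (e%:Z + 1) / t ^ e%:Z = N / d ^+ e.
    rewrite expfzDr // expr1z -[t ^ _]/(t ^+ _) -[N ^ _]/(N ^+ _) dE.
    by field; rewrite !expf_neq0.
  apply: upper => //; apply: le_trans (T_proj j).
  apply: (@le_trans _ _ #|` PrS [set~ j] T'|%:R); last first.
    by rewrite ler_nat fsubset_leq_card // PrS_subset.
  rewrite -cC; apply: card_PrS_mul_le => //.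
  + by rewrite setDE subsetIr.
  + by rewrite setCS sub1set inE.
  + by rewrite setCK subD1set.
Qed.
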